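(* Fix any request sequence. In each phase $P$ of Bucketing, the expected number of fetches satisfies $$\mathbb{E}[C+S]\le H_{\min\{k,\ell\}}\cdot \mathbb{E}[C],$$ where $C$ and $S$ are the numbers of clean and stale fetches during $P$ (the paper notes that $C$ does not depend on the random choices, so the bound reads $H_{\min\{k,\ell\}}\cdot C$).
   Context: Model: universe $\mathcal{U}$, DAG $G$, $T(x)$ = set of items reachable from $x$ in $G$ including $x$, each item has at most $k-1$ dependencies; a cache of at most $k$ items is feasible if it contains $T(x)$ for every cached $x$; on a request to $v$ the algorithm must make $T(v)$ cached via single fetches/evictions keeping feasibility; cost = number of fetches. $\tau$ is a fixed total order on $\mathcal{U}$ with $v<_\tau u$ whenever $v\in T(u)$, $v\ne u$. $\ell$: take the transitive closure of $G$, then its symmetric closure; $\ell$ is the size of a maximum independent set of the resulting undirected graph. $H_j=\sum_{i=1}^j1/i$. Algorithm Bucketing: maintains a pool $\Gamma$ of subsets (''buckets''). A set in $\Gamma$ is frozen if it is empty or if evicting its $\tau$-maximum element would make the cache infeasible; frozen sets are removed from $\Gamma$ immediately (''discard frozen sets''). ResetBuckets sets $\Gamma:=\{T(x): x$ cached and no other cached $y$ has $x\in T(y)\}$. Initially $\Gamma:=$ResetBuckets. On request $v$: for each $w\in T(v)$ in increasing $\tau$: (i) remove items of $T(v)$ from all sets of $\Gamma$, discard frozen sets; (ii) if $\Gamma=\emptyset$, set $\Gamma:=$ResetBuckets, then remove items of $T(v)$ from all sets and discard frozen sets; (iii) if $w$ is uncached: if the cache is full, choose $B\in\Gamma$ uniformly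 at random, let $y$ be its $\tau$-maximum item, remove $y$ from all sets, discard frozen sets, evict $y$; then fetch $w$. Then serve $v$. Phases: the pseudo-request sequence replaces each request $v$ by the items of $T(v)$ in increasing $\tau$ (one per loop iteration); a phase is the maximal subsequence of pseudo-requests processed between two consecutive calls to ResetBuckets. A fetch of $x$ during phase $P$ is clean if $x$ was not cached at the beginning of $P$, and stale otherwise. Expectations are over the random choices of Bucketing.
   Formalization: The bound is proved with the expectation of C on the right; the parenthetical remark that C does not depend on the random choices is not claimed, since phase boundaries, and hence C, can depend on them. *)

(* Defs.v *)
From HB Require Import structures.
From mathcomp Require Import all_boot all_order all_algebra.
Set Implicit Arguments. Unset Strict Implicit. Unset Printing Implicit Defensive.
Import Order.TTheory GRing.Theory Num.Theory.

(* Paging with dependencies: algorithm Bucketing, modelled exactly as a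
   finitely supported probability distribution (over rat) on final states. *)

Section Bucketing.
Variable U : finType.
Variable dep : rel U.          (* edge x -> y : x depends on y (DAG G) *)
Variable k : nat.
Variable tau : U -> nat.       (* the total order tau, as a rank function *)

Definition T (x : U) : {set U} := [set y | connect dep x y].

Definition dag : Prop := forall x y, dep x y -> ~~ connect dep y x.

Definition deps_bounded : Prop := forall x, #|T x :\ x| <= k.-1.

Definition tau_order : Prop :=
  injective tau /\ forall u v, v \in T u -> v != u -> tau v < tau u.

(* independent sets of the symmetric closure of the transitive closure *)
Definition antichain (A : {set U}) : bool :=
  [forall x in A, forall y in A, (x != y) ==> (x \notin T y)].
Definition ell : nat := \max_(A : {set U} | antichain A) #|A|.

Definition feasible (C : {set U}) : bool :=
  (#|C| <= k) && [forall x in C, T x \subset C].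

Definition taumax (B : {set U}) : option U :=
  [pick y in B | [forall z in B, tau z <= tau y]].

Definition frozen (C B : {set U}) : bool :=
  (B == set0) || (if taumax B is Some y then ~~ feasible (C :\ y) else true).

Definition discard (C : {set U}) (G : {set {set U}}) : {set {set U}} :=
  [set B in G | ~~ frozen C B].

Definition remove_items (X : {set U}) (G : {set {set U}}) : {set {set U}} :=
  [set B :\: X | B in G].

Definition reset_buckets (C : {set U}) : {set {set U}} :=
  [set T x | x in [set x in C | [forall y in C, (y != x) ==> (x \notin T y)]]].

(* state: cache, pool Gamma, current phase index, cache at start of current
   phase, log of fetches (phase index, clean?) *)
Record state := State {
  cache : {set U};
  buckets : {set {set U}};
  phase : nat;
  phase_start : {set U};
  log : seq (nat * bool) }.

Definition dist := seq (rat * state).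

Definition bind (d : dist) (f : state -> dist) : dist :=
  flatten [seq [seq ((p.1 * q.1)%R, q.2) | q <- f p.2] | p <- d].

(* one loop iteration for pseudo-request w of request v *)
Definition step (v w : U) (s : state) : dist :=
  let C := cache s in
  let G1 := discard C (remove_items (T v) (buckets s)) in
  let: (G2, ph, st) :=
    if G1 == set0 then (discard C (remove_items (T v) (reset_buckets C)), (phase s).+1, C)
    else (G1, phase s, phase_start s) in
  if w \in C then [:: (1%R, State C G2 ph st (log s))]
  else
    let lg := rcons (log s) (ph, w \notin st) in
    if (#|C| < k) || (G2 == set0) then [:: (1%R, State (w |: C) G2 ph st lg)]
    else [seq ((#|G2|%:R)^-1%R,
               if taumax B is Some y then
                 State (w |: (C :\ y)) (discard C (remove_items [set y] G2)) ph st lg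
               else State (w |: C) G2 ph st lg) | B <- enum G2].

Definition pseudo (v : U) : seq U := sort (fun a b => tau a <= tau b) (enum (T v)).

Definition serve (d : dist) (v : U) : dist :=
  foldl (fun d w => bind d (step v w)) d (pseudo v).

Definition init_state : state := State set0 (reset_buckets set0) 0 set0 [::].

Definition run (reqs : seq U) : dist := foldl serve [:: (1%R, init_state)] reqs.

Definition expect (d : dist) (f : state -> rat) : rat := (\sum_(p <- d) p.1 * f p.2)%R.

Definition clean_fetches (j : nat) (s : state) : nat := count (pred1 (j, true)) (log s).
Definition stale_fetches (j : nat) (s : state) : nat := count (pred1 (j, false)) (log s).

End Bucketing.

Definition harmonic (n : nat) : rat := (\sum_(i < n) (i.+1%:R)^-1)%R.

(* Main.v *)
(** While a phase lasts, the live buckets correspond to the maximal items of the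
    cache [C0] at its start that are still cached and unrequested: evicting the
    root of a bucket freezes the rest of it. So only these roots are evicted,
    and, as a root is treated like every other one until it is requested, the set
    [A] of the roots of live buckets is uniform among the subsets of its size of
    the set [N] of the unrequested roots. With [q] the number of items of [C0] that are
    uncached or in [N], the expected number of further stale fetches caused by
    the roots evicted so far is at most [(q - #|A|) * H_#|N| + #|A| - #|N|]:
    a stale fetch is paid by a unit drop, and a clean fetch raises it by at most
    [H_#|N| - 1]. There are at most [min(k, ell)] roots, since they form an
    antichain contained in the cache. *)

Require Import Defs.
From mathcomp Require Import all_boot all_order all_algebra.
From mathcomp Require Import ring lra.
Import Order.TTheory GRing.Theory Num.Theory.

Set Implicit Arguments.
Unset Strict Implicit.
Unset Printing Implicit Defensive.

(** * Harmonic numbers *)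

Lemma harmonicS n : harmonic n.+1 = (harmonic n + (n.+1%:R)^-1)%R.
Proof. by rewrite /harmonic big_ord_recr. Qed.

Lemma harmonic0 : harmonic 0 = 0%R.
Proof. by rewrite /harmonic big_ord0. Qed.

Lemma harmonic_le m n : m <= n -> (harmonic m <= harmonic n)%R.
Proof.
move=> /subnK <-; elim: (n - m) => [|d IH] //.
by rewrite addSn harmonicS (le_trans IH) // lerDl invr_ge0 ler0n.
Qed.

Lemma harmonic_ge1 n : 0 < n -> (1 <= harmonic n)%R.
Proof.
by move=> n0; apply: le_trans (harmonic_le n0); rewrite harmonicS harmonic0 invr1 add0r.
Qed.

(** * Sums over the subsets of a given size *)

Section SubsetSums.
Context (I : finType).
Implicit Types (N A : {set I}) (g : {set I} -> rat).
Local Open Scope ring_scope.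

Lemma sum_draws_mem N a x g : x \in N ->
  \sum_(A : {set I} | [&& A \subset N, #|A| == a.+1 & x \in A]) g A =
  \sum_(A : {set I} | (A \subset N :\ x) && (#|A| == a)) g (x |: A).
Proof.
move=> xN; rewrite (reindex_onto (fun A => x |: A) (fun A => A :\ x)) /=; last first.
  by move=> A /and3P[_ _ xA]; rewrite setD1K.
apply: eq_bigl => A; rewrite setU11 andbT subUset sub1set xN subsetD1 /=.
case xA: (x \in A).
  have -> : (x |: A) :\ x == A = false.
    by apply/eqP => E; move: xA; rewrite -E setD11.
  by rewrite !andbF.
by rewrite setU1K ?xA // eqxx andbT cardsU1 xA add1n eqSS andbT.
Qed.

(** Pascal's rule weighted by [g]: condition on whether [x] is drawn. *)
Lemma sum_drawsS N a x g : x \in N ->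
  \sum_(A : {set I} | (A \subset N) && (#|A| == a.+1)) g A =
  \sum_(A : {set I} | (A \subset N :\ x) && (#|A| == a)) g (x |: A) +
  \sum_(A : {set I} | (A \subset N :\ x) && (#|A| == a.+1)) g A.
Proof.
move=> xN; rewrite (bigID (fun A : {set I} => x \in A)) /=; congr (_ + _).
  by rewrite -sum_draws_mem //; apply: eq_bigl => A; rewrite andbA.
by apply: eq_bigl => A; rewrite subsetD1 andbAC.
Qed.

Lemma sum_draws0 N g :
  \sum_(A : {set I} | (A \subset N) && (#|A| == 0)%N) g A = g set0.
Proof.
rewrite (big_pred1 set0) // => A; rewrite cards_eq0 andbC /=.
by case: eqP => [->|//]; rewrite sub0set.
Qed.

Lemma sum_drawsT N g :
  \sum_(A : {set I} | (A \subset N) && (#|A| == #|N|)) g A = g N.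
Proof.
rewrite (big_pred1 N) // => A /=.
apply/andP/eqP => [[AN /eqP c]|->]; last by rewrite subxx.
by apply/eqP; rewrite eqEcard AN c leqnn.
Qed.

(** Double counting: an [a]-subset [A] arises once for each [y] in [N :\: A]. Hence dropping a
    uniform element of a uniform [a.+1]-subset leaves a uniform [a]-subset. *)
Lemma sum_draws_remove N a g :
  \sum_(A : {set I} | (A \subset N) && (#|A| == a.+1)) \sum_(y in A) g (A :\ y) =
  (#|N| - a)%:R * \sum_(A : {set I} | (A \subset N) && (#|A| == a)) g A.
Proof.
rewrite (exchange_big_dep (fun y => y \in N)) /=; last first.
  by move=> A y /andP[/subsetP AN _]; exact: AN.
under eq_bigr => y yN.
  under eq_bigl => A do rewrite -andbA.
  rewrite (sum_draws_mem _ (fun A => g (A :\ y)) yN).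
  under eq_bigr => A /andP[]; first by rewrite subsetD1 => /andP[_ yA] _; rewrite setU1K //; over.
  over.
rewrite (exchange_big_dep (fun A => (A \subset N) && (#|A| == a))) /=; last first.
  by move=> y A _ /andP[]; rewrite subsetD1 => /andP[-> _] ->.
rewrite mulr_sumr; apply: eq_bigr => A /andP[AN /eqP cA].
rewrite sumr_const mulr_natl; congr (_ *+ _).
rewrite -cA -(cardsDS AN); apply: eq_card => y.
by rewrite in_setD -[LHS]/([&& y \in N, A \subset N :\ y & #|A| == #|A|])
  subsetD1 AN eqxx andbT andbC.
Qed.

Lemma sum_draws_const N a (c : rat) :
  \sum_(A : {set I} | (A \subset N) && (#|A| == a)) c = 'C(#|N|, a)%:R * c.
Proof.
rewrite sumr_const mulr_natl -cards_draws; congr (_ *+ _).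
by apply: eq_card => A; rewrite !inE.
Qed.

End SubsetSums.

(** * The potential and its change when a root is requested *)

Definition potential (q n a : nat) : rat :=
  ((q%:R - a%:R) * harmonic n + a%:R - n%:R)%R.

Section Potential.
Local Open Scope ring_scope.

(** As [harmonic n >= 1] for positive [n], the value is at least [(q - a) + a - n = q - n]; for
    [n = 0] also [a = 0], and the value is 0. *)
Lemma potential_ge0 q n a : (a <= n <= q)%N -> 0 <= potential q n a.
Proof.
rewrite /potential; case: n => [|n] /andP[an nq].
  by move: an; rewrite leqn0 => /eqP ->; rewrite harmonic0 mulr0 subrr.
have H := harmonic_ge1 (ltn0Sn n).
have aq : (a%:R : rat) <= q%:R by rewrite ler_nat (leq_trans an).
have nq' : (n.+1%:R : rat) <= q%:R by rewrite ler_nat.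
have : (q%:R - a%:R) * 1 <= (q%:R - a%:R) * harmonic n.+1 by rewrite ler_wpM2l ?subr_ge0.
by rewrite mulr1; lra.
Qed.

(** The requested root has already been evicted, so [q] stays; the gain is [q / n.+1 - 1]. *)
Lemma potential_mark0 q n : (n < q)%N -> potential q n 0 <= potential q n.+1 0.
Proof.
move=> nq; rewrite /potential harmonicS.
have : 1 <= q%:R * (n.+1%:R : rat)^-1.
  by rewrite ler_pdivlMr ?ltr0n // mul1r ler_nat.
by rewrite -natr1; lra.
Qed.

(** The requested root is one of the [a.+1] live ones with probability [a.+1 / n.+1], and then both
    [q] and the number of live roots drop by one. The binomials are these probabilities with
    denominators cleared. *)
Lemma potential_markS q n a : (n < q)%N ->
  'C(n, a)%:R * potential q.-1 n a + 'C(n, a.+1)%:R * potential q n a.+1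
  <= 'C(n.+1, a.+1)%:R * potential q n.+1 a.+1.
Proof.
case: q => // q nq.
rewrite /potential harmonicS -pred_Sn.
have D : n.+1%:R * 'C(n, a)%:R = a.+1%:R * 'C(n.+1, a.+1)%:R :> rat.
  by rewrite -!natrM -mul_bin_diag.
have P : 'C(n.+1, a.+1)%:R = 'C(n, a)%:R + 'C(n, a.+1)%:R :> rat by rewrite binS natrD addrC.
set c1 := 'C(n, a)%:R in D P *; set c2 := 'C(n, a.+1)%:R in P *.
set c := 'C(_, _)%:R in D P *; set h := harmonic n.
have n0 : (n.+1%:R : rat) != 0 by rewrite pnatr_eq0.
set i := _^-1.
have ni : n.+1%:R * i = 1 by rewrite divff.
have Dc : c1 = i * a.+1%:R * c.
  by rewrite -mulrA -D mulrA [i * _]mulrC ni mul1r.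
have c0 : 0 <= c * i * (q%:R - n%:R).
  by rewrite !mulr_ge0 ?ler0n ?invr_ge0 ?ler0n // subr_ge0 ler_nat.
have c2E : c2 = c - c1 by rewrite P; ring.
rewrite -subr_ge0 c2E Dc; move: ni; rewrite -!natr1 => ni.
(* The first summand is the actual slack; the second vanishes by [ni]. *)
rewrite [X in 0 <= X](_ : _ = c * i * (q%:R - n%:R) + c * ((n%:R + 1) * i - 1)); last by ring.
by rewrite ni subrr mulr0 addr0.
Qed.

End Potential.

(** * Expectations over finite distributions *)

Section Expectation.
Context (U : finType).
Implicit Types (d : dist U) (f : state U -> rat).
Local Open Scope ring_scope.

Lemma expect_bind d (h : state U -> dist U) f :
  expect (bind d h) f = expect d (fun s => expect (h s) f).
Proof.
rewrite /expect /bind big_flatten big_map; apply: eq_bigr => p _.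
by rewrite big_map mulr_sumr; apply: eq_bigr => q _; rewrite mulrA.
Qed.

Lemma expect_dirac s f : expect [:: (1, s)] f = f s.
Proof. by rewrite /expect big_seq1 mul1r. Qed.

Lemma expectB d f g : expect d (fun s => f s - g s) = expect d f - expect d g.
Proof. by rewrite /expect -sumrB; apply: eq_bigr => p _; rewrite mulrBr. Qed.

Lemma expectZ d c f : expect d (fun s => c * f s) = c * expect d f.
Proof. by rewrite /expect mulr_sumr; apply: eq_bigr => p _; rewrite mulrCA. Qed.

End Expectation.

(** * Reachability, feasible caches and their roots *)

Section Bucketing.
Context (U : finType) (dep : rel U) (k : nat) (tau : U -> nat).
Hypothesis Hk : 0 < k.
Hypothesis Hdeps : deps_bounded dep k.
Hypothesis Htau : tau_order dep tau.
Implicit Types (x y z v w : U) (A B C K N R X : {set U}) (G : {set {set U}}).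
Implicit Types (s : state U) (lg : seq (nat * bool)) (L : seq (U * U)).

Local Notation T := (T dep).

Lemma T_refl x : x \in T x.
Proof. by rewrite inE connect0. Qed.

Lemma T_sub x y : y \in T x -> T y \subset T x.
Proof. by rewrite inE => xy; apply/subsetP => z; rewrite !inE; apply: connect_trans. Qed.

Lemma T_tau_le x y : y \in T x -> tau y <= tau x.
Proof. by case: (eqVneq y x) => [->//|yx] /Htau.2 /(_ yx) /ltnW. Qed.

Lemma card_T v : #|T v| <= k.
Proof. by rewrite (cardsD1 v) T_refl -(prednK Hk) ltnS Hdeps. Qed.

Definition closed C := forall x, x \in C -> T x \subset C.

Lemma feasibleP C : reflect (#|C| <= k /\ closed C) (feasible dep k C).
Proof.
apply: (iffP andP) => [[c /forallP h]|[c h]]; split=> //.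
  by move=> x xC; move/implyP: (h x); exact.
by apply/forallP => x; apply/implyP; exact: h.
Qed.

Lemma taumax_eq B x : x \in B -> (forall z, z \in B -> tau z <= tau x) -> taumax tau B = Some x.
Proof.
move=> xB xm; rewrite /taumax; case: pickP => [y /andP[yB /forallP ym]|/(_ x)].
  congr Some; apply: Htau.1; apply/eqP; rewrite eqn_leq xm //=.
  by move/implyP: (ym x); exact.
by rewrite xB /=; case/forallP => z; apply/implyP; exact: xm.
Qed.

Lemma taumax_in B x : taumax tau B = Some x -> x \in B.
Proof. by rewrite /taumax; case: pickP => // y /andP[yB _] [<-]. Qed.

Lemma unfrozenP C B : ~~ frozen dep k tau C B ->
  exists2 y, taumax tau B = Some y & feasible dep k (C :\ y).
Proof.
rewrite /frozen; case: taumax => [y|]; last by rewrite orbT.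
by rewrite negb_or negbK => /andP[_ f]; exists y.
Qed.

Definition roots C : {set U} := [set x in C | [forall y in C, (y != x) ==> (x \notin T y)]].

Lemma roots_sub C : roots C \subset C.
Proof. by apply/subsetP => x; rewrite inE => /andP[]. Qed.

Lemma rootsP C x y : x \in roots C -> y \in C -> x \in T y -> y = x.
Proof.
rewrite inE => /andP[_ /forallP h] yC xy; apply/eqP; apply: contraTT xy => yx.
by move: (h y); rewrite yC yx.
Qed.

(** Among the cached items that reach [x], the [tau]-maximal one is a root. *)
Lemma below_root C x : x \in C -> exists2 r, r \in roots C & x \in T r.
Proof.
move=> xC; pose P z := (z \in C) && (x \in T z).
have Px : P x by rewrite /P xC T_refl.
case: (arg_maxnP tau Px) => r /andP[rC xr] rm; exists r => //.
rewrite inE rC; apply/forallP => y; apply/implyP => yC; apply/implyP => yr.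
apply/negP => ry; have /rm : P y by rewrite /P yC (subsetP (T_sub ry)).
by rewrite /= leqNgt (Htau.2 y r) // eq_sym.
Qed.

Lemma roots_antichain C : antichain dep (roots C).
Proof.
apply/forallP => x; apply/implyP => xr; apply/forallP => y; apply/implyP => yr.
apply/implyP => xy; apply/negP => xTy.
have yx := rootsP xr (subsetP (roots_sub C) _ yr) xTy.
by move: xy; rewrite yx eqxx.
Qed.

Lemma card_roots C : #|C| <= k -> #|roots C| <= minn k (ell dep).
Proof.
move=> c; rewrite leq_min (leq_trans (subset_leq_card (roots_sub C)) c) /=.
exact: (@leq_bigmax_cond _ _ (fun A : {set U} => #|A|) _ (roots_antichain C)).
Qed.

Lemma ell_gt0 v : 0 < minn k (ell dep).
Proof.
rewrite leq_min Hk; have A : antichain dep [set v].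
  apply/forallP => x; apply/implyP => /set1P ->.
  by apply/forallP => y; apply/implyP => /set1P ->; rewrite eqxx.
by have := @leq_bigmax_cond _ _ (fun B : {set U} => #|B|) _ A; rewrite cards1.
Qed.

(** * The shape of the pool during a phase *)

(** [A] holds the roots of the live buckets and [R] the items removed by requests. Evicted roots
    only leave [A], since no other bucket contains them. *)
Definition trees R A : {set {set U}} := [set T x :\: R | x in A].

Lemma taumax_tree R x : x \notin R -> taumax tau (T x :\: R) = Some x.
Proof.
move=> xR; apply: taumax_eq; first by rewrite inE xR T_refl.
by move=> z; rewrite inE => /andP[_]; exact: T_tau_le.
Qed.

(** A root is recovered as the [tau]-maximum of its tree, so choosing a uniform bucket amounts to
    choosing a uniform live root. *)
Lemma trees_inj R A : [disjoint A & R] -> {in A &, injective (fun x => T x :\: R)}.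
Proof.
move=> AR x y xA yA /= E; have := taumax_tree (negbT (disjointFr AR xA)).
by rewrite E (taumax_tree (negbT (disjointFr AR yA))) => -[].
Qed.

Lemma trees_eq0 R A : (trees R A == set0) = (A == set0).
Proof. by rewrite /trees imset_eq0. Qed.

(* Each item of [N] is maximal in [K :|: N]: this is the shape of the cache
   during a phase, with [N] the unrequested roots of the initial cache. *)
Definition crowned K N :=
  [/\ [disjoint K & N], closed K & forall x, x \in N -> T x \subset x |: K].

Lemma crowned_max K N x z : crowned K N -> x \in N -> z \in K :|: N -> x \in T z -> x = z.
Proof.
move=> [KN cK cN] xN; rewrite inE => /orP[zK|zN] xz.
  by move: (disjointFl KN xN); rewrite (subsetP (cK _ zK)).
move: (subsetP (cN _ zN) _ xz); rewrite !inE => /orP[/eqP //|xK].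
by rewrite (disjointFr KN xK) in xN.
Qed.

Lemma crowned_closed K N A : crowned K N -> A \subset N -> closed (K :|: A).
Proof.
move=> [_ cK cN] /subsetP AN z; rewrite inE => /orP[/cK h|zA].
  exact: subset_trans h (subsetUl _ _).
apply: subset_trans (cN _ (AN _ zA)) _.
by rewrite subUset subsetUl sub1set inE zA orbT.
Qed.

Lemma crowned_feasible K N A x : crowned K N -> A \subset N -> #|K :|: A| <= k ->
  x \in A -> feasible dep k ((K :|: A) :\ x).
Proof.
move=> cKN AN cA xA; apply/feasibleP; split.
  by apply: leq_trans cA; rewrite subset_leq_card // subD1set.
move=> z; rewrite in_setD1 => /andP[zx zKA].
rewrite subsetD1 (crowned_closed cKN AN zKA) /=; apply/negP => xz.
have zKN : z \in K :|: N by apply: subsetP zKA; rewrite setUS.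
by rewrite (crowned_max cKN (subsetP AN _ xA) zKN xz) eqxx in zx.
Qed.

(** A bucket with root outside [X] stays unfrozen, because by [crowned_feasible] its root can be
    evicted; the last hypothesis disposes of the other buckets. *)
Lemma discard_trees K N A R X : crowned K N -> A \subset N -> #|K :|: A| <= k ->
  [disjoint N & R] ->
  (forall x, x \in A -> x \in X -> frozen dep k tau (K :|: A) (T x :\: (R :|: X))) ->
  discard dep k tau (K :|: A) (remove_items X (trees R A)) = trees (R :|: X) (A :\: X).
Proof.
move=> cKN AN cA NR Xf; apply/setP => B; rewrite inE.
apply/andP/imsetP => [[/imsetP[B' /imsetP[x xA ->] ->]]|[x xAX ->]].
  move=> nf; exists x; last by rewrite setDDl.
  by rewrite inE xA andbT; apply: contra nf => /(Xf _ xA); rewrite setDDl.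
move: xAX; rewrite inE => /andP[xX xA]; split.
  by apply/imsetP; exists (T x :\: R); [exact: (imset_f (fun z => T z :\: R)) | rewrite setDDl].
have xR : x \notin R :|: X.
  by rewrite inE (negbTE xX) orbF (disjointFr NR) // (subsetP AN).
rewrite /frozen taumax_tree // (crowned_feasible cKN) // orbF.
by apply/set0Pn; exists x; rewrite in_setD xR T_refl.
Qed.

Lemma discard_trees_request v K N A R : crowned K N -> A \subset N -> #|K :|: A| <= k ->
  [disjoint N & R] ->
  discard dep k tau (K :|: A) (remove_items (T v) (trees R A)) = trees (R :|: T v) (A :\: T v).
Proof.
move=> cKN AN cA NR; apply: discard_trees cKN AN cA NR _ => x _ /T_sub xv.
rewrite /frozen (_ : _ :\: _ = set0) ?eqxx //; apply/eqP.
by rewrite setD_eq0 subsetU // xv orbT.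
Qed.

(* The cache still contains the evicted [y] when frozen sets are discarded, so
   the rest of the bucket of [y] is always discarded with it. *)
Lemma discard_trees_evict y K N A R : crowned K N -> A \subset N -> #|K :|: A| <= k ->
  [disjoint N & R] -> y \in A ->
  discard dep k tau (K :|: A) (remove_items [set y] (trees R A)) = trees R (A :\ y).
Proof.
move=> cKN AN cA NR yA.
rewrite (discard_trees cKN) //.
  apply: eq_in_imset => x /setD1P[xy xA]; rewrite -setDDl; apply/setP => z.
  rewrite in_setD in_set1; case: eqP => [->|//] /=; rewrite in_setD.
  apply/esym/negbTE; rewrite negb_and negbK; apply/orP; right; apply/negP => yx.
  have xKN : x \in K :|: N by rewrite inE (subsetP AN) ?orbT.
  by rewrite (crowned_max cKN (subsetP AN _ yA) xKN yx) eqxx in xy.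
move=> x _ /set1P ->; rewrite /frozen; case E: taumax => [z|]; last by rewrite orbT.
(* The new maximum [z] is a dependency of [y], which is still cached, so [z] cannot be evicted. *)
have := taumax_in E; rewrite !inE => /andP[/norP[_ zy] zTy].
apply/orP; right; apply/feasibleP => -[_ /(_ y)].
rewrite !inE eq_sym zy yA orbT => /(_ isT) /subsetP /(_ z).
by rewrite !inE zTy eqxx => /(_ isT).
Qed.

(** * One loop iteration, and sequences of pseudo-requests *)

Definition evict w C G ph C0 lg B : state U :=
  if taumax tau B is Some y then
    State (w |: (C :\ y)) (discard dep k tau C (remove_items [set y] G)) ph C0 lg
  else State (w |: C) G ph C0 lg.

(** What remains of [step] once the pool is settled, shared by the branches with and without a
    reset. *)
Definition process w C G ph C0 lg : dist U :=
  if w \in C then [:: (1%R, State C G ph C0 lg)] else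
  let lg' := rcons lg (ph, w \notin C0) in
  if (#|C| < k) || (G == set0) then [:: (1%R, State (w |: C) G ph C0 lg')]
  else [seq ((#|G|%:R)^-1%R, evict w C G ph C0 lg' B) | B <- enum G].

Lemma stepE v w s :
  let C := cache s in
  let G := discard dep k tau C (remove_items (T v) (buckets s)) in
  step dep k tau v w s =
  if G == set0 then
    process w C (discard dep k tau C (remove_items (T v) (reset_buckets dep C)))
      (phase s).+1 C (log s)
  else process w C G (phase s) (phase_start s) (log s).
Proof. by rewrite /step /=; case: ifP. Qed.

Lemma expect_process_evict w C G ph C0 lg (f : state U -> rat) :
  w \notin C -> k <= #|C| -> G != set0 ->
  (expect (process w C G ph C0 lg) f =
   (#|G|%:R)^-1 * \sum_(B in G) f (evict w C G ph C0 (rcons lg (ph, w \notin C0)) B))%R.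
Proof.
move=> /negbTE wC kC /negbTE G0; rewrite /process wC ltnNge kC G0 /=.
by rewrite /expect big_map big_enum /= mulr_sumr.
Qed.

Lemma expect_process_le w C G ph C0 lg (f : state U -> rat) (c : rat) :
  (forall B, B \in G -> ~~ frozen dep k tau C B) ->
  (w \in C -> f (State C G ph C0 lg) <= c)%R ->
  (w \notin C -> (#|C| < k)%N || (G == set0) ->
   f (State (w |: C) G ph C0 (rcons lg (ph, w \notin C0))) <= c)%R ->
  (forall B y, w \notin C -> (k <= #|C|)%N -> B \in G -> taumax tau B = Some y ->
   feasible dep k (C :\ y) ->
   f (State (w |: (C :\ y)) (discard dep k tau C (remove_items [set y] G)) ph C0
        (rcons lg (ph, w \notin C0))) <= c)%R ->
  (expect (process w C G ph C0 lg) f <= c)%R.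
Proof.
move=> Gu hin hfree hev; case wC: (w \in C).
  by rewrite /process wC expect_dirac; apply: hin.
case F: ((#|C| < k) || (G == set0)).
  by rewrite /process wC F expect_dirac; apply: hfree; rewrite ?wC.
move/norP: (negbT F) => []; rewrite -leqNgt => kC G0.
rewrite expect_process_evict ?wC //.
have g0 : (0 < #|G|%:R :> rat)%R by rewrite ltr0n card_gt0.
rewrite mulrC ler_pdivrMr // mulr_natr -sumr_const; apply: ler_sum => B BG.
have [y yB fy] := unfrozenP (Gu _ BG).
by rewrite /evict yB; apply: hev BG yB fy; rewrite ?wC.
Qed.

Lemma discard_unfrozen C G B : B \in discard dep k tau C G -> ~~ frozen dep k tau C B.
Proof. by rewrite inE => /andP[]. Qed.

(* [L] lists pairs (request [v], pseudo-request [w]); since items of [T v] are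
   never evicted while [v] is processed, only they are assumed to remain cached. *)
Fixpoint servable L C : Prop :=
  if L is (v, w) :: L' then
    [/\ w \in T v, T w \subset w |: C &
      forall C', w |: (C :&: T v) \subset C' -> servable L' C']
  else True.

Lemma servable_sub L C C' : C \subset C' -> servable L C -> servable L C'.
Proof.
case: L => // -[v w] L CC' [wv wC h]; split=> //.
  by apply: subset_trans wC _; rewrite setUS.
by move=> D wD; apply: h; apply: subset_trans wD; rewrite setUS ?setSI.
Qed.

Lemma pseudo_mem v w : (w \in pseudo dep tau v) = (w \in T v).
Proof. by rewrite mem_sort mem_enum. Qed.

(** Here [s1] is the part of [T v] already handled. Since [pseudo] is sorted by [tau], every proper
    dependency of the next [w] lies in [s1] and so is cached. *)
Lemma servable_pseudo v L (s1 s2 : seq U) C : (forall C', servable L C') ->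
  pseudo dep tau v = s1 ++ s2 -> {subset s1 <= C} ->
  servable ([seq (v, w) | w <- s2] ++ L) C.
Proof.
move=> HL; elim: s2 s1 C => [|w s2 IH] s1 C E s1C //=.
have sE x : (x \in T v) = (x \in s1 ++ w :: s2) by rewrite -pseudo_mem E.
have wv : w \in T v by rewrite sE mem_cat mem_head orbT.
split=> //.
  apply/subsetP => z zw; rewrite in_setU1; case: eqVneq => //= zw'.
  have : z \in s1 ++ w :: s2 by rewrite -sE (subsetP (T_sub wv)).
  rewrite mem_cat inE (negbTE zw') /= => /orP[/s1C //|zs2].
  have : sorted (fun a b => tau a <= tau b) (pseudo dep tau v).
    by apply: sort_sorted => a b; apply: leq_total.
  have tr : transitive (fun a b => tau a <= tau b) by move=> a b c; apply: leq_trans.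
  rewrite E sorted_pairwise // pairwise_cat /= => /and3P[_ _ /andP[/allP /(_ z zs2)]].
  by rewrite leqNgt (Htau.2 w z).
move=> C' wC'; apply: (IH (rcons s1 w)); first by rewrite cat_rcons.
move=> x; rewrite mem_rcons inE => xs; apply: (subsetP wC').
rewrite in_setU1; case: eqVneq xs => //= _ xs.
by rewrite inE s1C // sE mem_cat xs.
Qed.

Definition pseudo_requests (reqs : seq U) :=
  flatten [seq [seq (v, w) | w <- pseudo dep tau v] | v <- reqs].

Lemma servable_requests reqs C : servable (pseudo_requests reqs) C.
Proof.
by elim: reqs C => //= v reqs IH C; apply: (servable_pseudo (s1 := [::])).
Qed.

(** * Expected cost of phase [j] from a given state *)

Section Value.
Variable j : nat.
Let M := minn k (ell dep).
Local Open Scope ring_scope.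

(** The theorem says that this quantity has nonpositive mean at the end of the run. *)
Definition log_cost lg : rat :=
  (count (pred1 (j, true)) lg + count (pred1 (j, false)) lg)%:R
  - harmonic M * (count (pred1 (j, true)) lg)%:R.

Lemma log_cost_rcons lg i b : log_cost (rcons lg (i, b)) =
  log_cost lg + (i == j)%:R * (1 - harmonic M * b%:R).
Proof.
rewrite /log_cost -cats1 !count_cat /= !addn0 !xpair_eqE.
by case: eqP => _; case: b; rewrite /= !natrD /=; ring.
Qed.

(** Recursion on the remaining requests lets single states be bounded instead of distributions;
    [expect_value] relates it to the run. *)
Fixpoint value L s : rat :=
  if L is vw :: L' then expect (step dep k tau vw.1 vw.2 s) (value L')
  else log_cost (log s).

Lemma expect_process_after w C G ph C0 lg L : (j < ph)%N ->
  (forall s, (j < phase s)%N -> value L s <= log_cost (log s)) ->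
  expect (process w C (discard dep k tau C G) ph C0 lg) (value L) <= log_cost lg.
Proof.
move=> jp h; have E b : log_cost (rcons lg (ph, b)) = log_cost lg.
  by rewrite log_cost_rcons gtn_eqF // mul0r addr0.
by apply: expect_process_le;
  first [exact: discard_unfrozen | move=> *; apply: le_trans (h _ _) _ => //=; rewrite E].
Qed.

(** Phase indices never decrease, so no further fetch is logged under [j]. *)
Lemma value_after L s : (j < phase s)%N -> value L s <= log_cost (log s).
Proof.
elim: L s => [//|[v w] L IH] s js; rewrite [value _ _]/= stepE /=.
by case: ifP => _; apply: expect_process_after => //; apply: ltnW.
Qed.

(** An empty pool is reset by the next iteration, which carries the phase index past [j]. *)
Lemma value_no_bucket L s : buckets s = set0 -> (j <= phase s)%N ->
  value L s <= log_cost (log s).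
Proof.
case: L => [//|[v w] L] b0 js; rewrite [value _ _]/= stepE /= b0.
have -> : discard dep k tau (cache s) (remove_items (T v) set0) = set0.
  by apply/setP => B; rewrite !inE /remove_items imset0 inE.
by rewrite eqxx; apply: expect_process_after => // s'; exact: value_after.
Qed.

(** * The bound within phase [j] *)

Definition phase_state C0 K A R lg := State (K :|: A) (trees R A) j C0 lg.

(** Only the number [a] of live roots enters, so that one configuration covers all [a]-subsets [A]
    of [N]; the cache then has [#|K| + a] items. *)
Definition phase_config C0 K N a :=
  [/\ crowned K N, N \subset C0, (#|N| <= M)%N & (#|K| + a <= k)%N].

Lemma crowned_unmark K N x : crowned K N -> x \in N -> crowned K (N :\ x).
Proof.
move=> [KN cK cN] xN; split=> // [|y /setD1P[_]]; last exact: cN.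
by apply: disjointWr KN; rewrite subD1set.
Qed.

Lemma crowned_add K N x : crowned K N -> x \notin N -> T x \subset x |: K ->
  crowned (x |: K) N.
Proof.
move=> [KN cK cN] xN Tx; split.
- rewrite disjoints_subset subUset sub1set inE xN -disjoints_subset.
  exact: KN.
- move=> z; rewrite in_setU1 => /predU1P[->//|/cK h].
  exact: subset_trans h (subsetUr _ _).
- by move=> y /cN h; apply: subset_trans h _; rewrite setUS // subsetUr.
Qed.

Lemma crowned_mark K N x : crowned K N -> x \in N -> crowned (x |: K) (N :\ x).
Proof.
move=> c xN; apply: crowned_add; first exact: crowned_unmark.
  by rewrite setD11.
by case: c => _ _; apply.
Qed.

Lemma card_crowned C0 K N : crowned K N -> N \subset C0 -> (#|N| <= #|C0 :\: K|)%N.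
Proof.
by move=> [KN _ _] NC; rewrite subset_leq_card // subsetD NC disjoint_sym.
Qed.

Lemma card_setDU1 C0 K x : x \notin K -> (#|C0 :\: K| = (x \in C0) + #|C0 :\: (x |: K)|)%N.
Proof.
by move=> xK; rewrite (cardsD1 x) in_setD xK /= -setDDl setDDl setUC setDDl.
Qed.

(* When the items of [X] are requested, condition on which of them are still
   cached, one at a time. *)
Lemma sum_mark (F : {set U} -> {set U} -> rat) X C0 (c : rat) K N a :
  phase_config C0 K N a ->
  (forall K' N' a', K \subset K' -> N' \subset N -> [disjoint N' & X] ->
    phase_config C0 K' N' a' ->
    \sum_(A : {set U} | (A \subset N') && (#|A| == a')) F K' A
    <= 'C(#|N'|, a')%:R * (c + potential #|C0 :\: K'| #|N'| a')) ->
  \sum_(A : {set U} | (A \subset N) && (#|A| == a)) F (K :|: (A :&: X)) (A :\: X)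
  <= 'C(#|N|, a)%:R * (c + potential #|C0 :\: K| #|N| a).
Proof.
elim: {N}_.+1 {-2}N (ltnSn #|N|) K a => // m IH N Nm K a cfg base.
case: (boolP [disjoint N & X]) => [NX|].
  have := base _ _ a (subxx K) (subxx N) NX cfg.
  apply: le_trans; rewrite le_eqVlt; apply/orP; left; apply/eqP.
  apply: eq_bigr => A /andP[AN _]; have AX := disjointWl AN NX.
  by rewrite (disjoint_setI0 AX) setU0 (setDidPl AX).
move=> /pred0Pn[x /andP[/= xN xX]].
have [cKN NC NM Kk] := cfg.
have xK : x \notin K by case: cKN => KN _ _; rewrite (disjointFl KN xN).
have cN : #|N| = #|N :\ x|.+1 by rewrite (cardsD1 x N) xN.
have Nm' : (#|N :\ x| < m)%N by rewrite -ltnS -cN.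
have subN : N :\ x \subset N := subD1set N x.
have unmark b : (#|K| + b <= k)%N -> phase_config C0 K (N :\ x) b.
  move=> Kb; split=> //; first exact: crowned_unmark.
    exact: subset_trans subN NC.
  by rewrite (leq_trans _ NM) // subset_leq_card.
have baseU K' N' a' : K \subset K' -> N' \subset N :\ x -> [disjoint N' & X] ->
    phase_config C0 K' N' a' ->
    \sum_(A : {set U} | (A \subset N') && (#|A| == a')) F K' A
    <= 'C(#|N'|, a')%:R * (c + potential #|C0 :\: K'| #|N'| a').
  by move=> KK' NN'; apply: base => //; apply: subset_trans subN.
have IHU b : (#|K| + b <= k)%N -> 
    \sum_(A : {set U} | (A \subset N :\ x) && (#|A| == b)) F (K :|: (A :&: X)) (A :\: X)
    <= 'C(#|N :\ x|, b)%:R * (c + potential #|C0 :\: K| #|N :\ x| b).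
  by move=> Kb; apply: IH (unmark _ Kb) _.
have nq : (#|N :\ x| < #|C0 :\: K|)%N by rewrite -cN card_crowned.
(* Without live roots, [x] has been evicted and merely leaves [N]. *)
case: a Kk {cfg} => [|a] Kk.
  rewrite sum_draws0 -(sum_draws0 (N :\ x) (fun A => F (K :|: (A :&: X)) (A :\: X))).
  apply: le_trans (IHU _ Kk) _; rewrite !bin0 !mul1r lerD2l cN.
  exact: potential_mark0.
(* Either [x] is live and moves to [K], or it has been evicted and leaves [N]. *)
rewrite (sum_drawsS a _ xN).
have xKk : (#|x |: K| + a <= k)%N by rewrite cardsU1 xK addnAC add1n addnC addnS -addnS.
have /IH : phase_config C0 (x |: K) (N :\ x) a.
  have [_ NC' NM' _] := unmark _ Kk.
  by split=> //; exact: crowned_mark.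
move=> /(_ Nm').
have baseM K' N' a' : x |: K \subset K' -> N' \subset N :\ x -> [disjoint N' & X] ->
    phase_config C0 K' N' a' ->
    \sum_(A : {set U} | (A \subset N') && (#|A| == a')) F K' A
    <= 'C(#|N'|, a')%:R * (c + potential #|C0 :\: K'| #|N'| a').
  by rewrite subUset => /andP[_ KK']; exact: baseU.
move=> /(_ baseM) hM.
have hM' : \sum_(A : {set U} | (A \subset N :\ x) && (#|A| == a))
     F (K :|: (x |: A) :&: X) ((x |: A) :\: X) <=
     'C(#|N :\ x|, a)%:R * (c + potential #|C0 :\: (x |: K)| #|N :\ x| a).
  apply: le_trans hM; rewrite le_eqVlt; apply/orP; left; apply/eqP.
  apply: eq_bigr => A _; congr (F _ _); apply/setP => y; rewrite !inE.
    by case: eqVneq => [->|_] //=; rewrite xX orbT.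
  by case: eqVneq => [->|_] //=; rewrite xX.
apply: le_trans (lerD hM' (IHU _ Kk)) _.
have xC : x \in C0 := subsetP NC _ xN.
have -> : #|C0 :\: (x |: K)| = #|C0 :\: K|.-1 by rewrite (card_setDU1 C0 xK) xC.
have := potential_markS a nq; rewrite cN binS natrD => h.
lra.
Qed.

(* The sum stands for an expectation over a uniform [#|A|]-subset [A] of [N]: the
   bound fails for an individual [A], as the future requests are fixed. *)
Lemma phase_bound C0 L K N R a lg :
  servable L K -> phase_config C0 K N a -> [disjoint N & R] ->
  \sum_(A : {set U} | (A \subset N) && (#|A| == a)) value L (phase_state C0 K A R lg)
  <= 'C(#|N|, a)%:R * (log_cost lg + potential #|C0 :\: K| #|N| a).
Proof.
elim: L K N R a lg => [|[v w] L IH] K N R a lg sK cfg NR.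
  rewrite /= sum_draws_const; case: (leqP a #|N|) => aN; last by rewrite bin_small ?mul0r.
  have [cKN NC _ _] := cfg.
  by rewrite ler_wpM2l ?ler0n // lerDl potential_ge0 // aN card_crowned.
have [cKN NC NM Kk] := cfg.
set R' := R :|: T v.
(* [F] is the rest of the iteration after the requested live roots have moved from [A] to [K']; the
   pool is reset exactly when no live root remains. *)
pose F K' A := expect
  (if A == set0 then
     process w (K' :|: A)
       (discard dep k tau (K' :|: A) (remove_items (T v) (reset_buckets dep (K' :|: A))))
       j.+1 (K' :|: A) lg
   else process w (K' :|: A) (trees R' A) j C0 lg) (value L).
have -> : \sum_(A : {set U} | (A \subset N) && (#|A| == a))
    value ((v, w) :: L) (phase_state C0 K A R lg) =
  \sum_(A : {set U} | (A \subset N) && (#|A| == a)) F (K :|: (A :&: T v)) (A :\: T v).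
  apply: eq_bigr => A /andP[AN /eqP cA].
  have cKA : (#|K :|: A| <= k)%N.
    by rewrite (leq_trans _ Kk) // -cA (leq_card_setU K A).1.
  rewrite [LHS]/= stepE /= (discard_trees_request _ cKN) //.
  by rewrite trees_eq0 /F -setUA setID.
apply: (sum_mark cfg) => {}K' {}N' {}a' KK' NN' NX cfg'.
have {sK} [wv Tw sL] := servable_sub KK' sK.
have {NR NN'} NR' : [disjoint N' & R'].
  by rewrite disjoints_subset setCU subsetI -!disjoints_subset NX (disjointWl NN' NR).
have [cKN' NC' NM' Kk'] := cfg'.
have wN : w \notin N' by rewrite (disjointFl NX wv).
have cardK A : A \subset N' -> #|K' :|: A| = (#|K'| + #|A|)%N.
  case: cKN' => KN _ _ AN; apply/eqP; rewrite (leq_card_setU K' A).2.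
  exact: disjointWr KN.
(* With no live root, phase [j] is over, and nonnegativity of the potential suffices. *)
case: a' cfg' Kk' => [|b] cfg' Kk'.
  rewrite sum_draws0 bin0 mul1r /F eqxx; apply: (@le_trans _ _ (log_cost lg)); last first.
    by rewrite lerDl potential_ge0 // card_crowned.
  by apply: expect_process_after => // s'; exact: value_after.
case: (leqP b.+1 #|N'|) => [bN|Nb]; last first.
  rewrite bin_small // mul0r big_pred0 // => A; apply/negbTE/negP => /andP[AN /eqP cA].
  by have := subset_leq_card AN; rewrite cA leqNgt Nb.
have A0 A : #|A| == b.+1 -> A == set0 = false.
  by apply: contraTF => /eqP ->; rewrite cards0.
have H1 : 1 <= harmonic #|N'| by apply: harmonic_ge1; apply: leq_trans bN.
have HM : harmonic #|N'| <= harmonic M by apply: harmonic_le.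
have in_KA A : A \subset N' -> (w \in K' :|: A) = (w \in K').
  move=> AN; rewrite in_setU; case wA: (w \in A); rewrite ?orbF //.
  by rewrite (subsetP AN _ wA) in wN.
case wK: (w \in K').
  have sL' : servable L K' by apply: sL; rewrite subUset sub1set wK subsetIl.
  apply: le_trans (IH _ _ _ _ lg sL' cfg' NR'); rewrite le_eqVlt; apply/orP; left.
  apply/eqP/eq_bigr => A /andP[AN cA].
  by rewrite /F A0 // /process in_KA // wK expect_dirac.
have {sL} sL : servable L (w |: K') by apply: sL; rewrite setUS ?subsetIl.
set lg' := rcons lg (j, w \notin C0).
have lgE : log_cost lg' = log_cost lg + (1 - harmonic M * (w \notin C0)%:R).
  by rewrite log_cost_rcons eqxx mul1r.
have qE : (#|C0 :\: K'|%:R : rat) = (w \in C0)%:R + #|C0 :\: (w |: K')|%:R.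
  by rewrite -natrD -card_setDU1 ?wK.
have cKN'' : crowned (w |: K') N' by apply: crowned_add.
have cwK : #|w |: K'| = #|K'|.+1 by rewrite cardsU1 wK.
(* If there is room, nothing is evicted. A stale [w] lowers [q] by one, hence the potential by
   [harmonic #|N'| >= 1], which pays for the fetch; a clean one costs [1 - harmonic M <= 0]. *)
case: (ltnP (#|K'| + b.+1) k) => Kb.
  have cfg'' : phase_config C0 (w |: K') N' b.+1 by split=> //; rewrite cwK.
  apply: (@le_trans _ _ ('C(#|N'|, b.+1)%:R *
      (log_cost lg' + potential #|C0 :\: (w |: K')| #|N'| b.+1))).
    apply: le_trans (IH _ _ _ _ lg' sL cfg'' NR'); rewrite le_eqVlt; apply/orP; left.
    apply/eqP/eq_bigr => A /andP[AN cA].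
    rewrite /F A0 // /process in_KA // wK cardK // (eqP cA) Kb expect_dirac.
    by rewrite /phase_state setUA.
  rewrite ler_wpM2l ?ler0n // lgE /potential qE.
  by case: (w \in C0); rewrite /=; lra.
have cfg'' : phase_config C0 (w |: K') N' b by split=> //; rewrite cwK addSnnS.
have b0 : (0 < b.+1%:R :> rat) by rewrite ltr0n.
have -> : \sum_(A : {set U} | (A \subset N') && (#|A| == b.+1)) F K' A =
    b.+1%:R^-1 * \sum_(A : {set U} | (A \subset N') && (#|A| == b.+1))
      \sum_(y in A) value L (phase_state C0 (w |: K') (A :\ y) R' lg').
  rewrite mulr_sumr; apply: eq_bigr => A /andP[AN cA].
  have AR : [disjoint A & R'] := disjointWl AN NR'.
  rewrite /F A0 // expect_process_evict; first last.
  - by rewrite trees_eq0 A0.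
  - by rewrite cardK // (eqP cA).
  - by rewrite in_KA // wK.
  rewrite {1}/trees card_in_imset; last exact: trees_inj.
  rewrite (eqP cA) /trees big_imset; last exact: trees_inj.
  congr (_ * _); apply: eq_bigr => y yA.
  rewrite /evict taumax_tree ?(disjointFr AR yA) // -/(trees R' A).
  have kKA : (#|K' :|: A| <= k)%N by rewrite cardK // (eqP cA).
  rewrite (discard_trees_evict cKN') //; congr (value _ (State _ _ _ _ _)).
  apply/setP => z; rewrite !inE -orbA; congr (_ || _).
  case: eqVneq => //= ->; rewrite orbF; apply/esym.
  by case: cKN' => KN _ _; rewrite (disjointFl KN) // (subsetP AN).
(* The surviving roots form a uniform [b]-subset of [N']; [mul_bin_left] matches the binomials. *)
rewrite (sum_draws_remove N' b
  (fun A => value L (phase_state C0 (w |: K') A R' lg'))) mulrC ler_pdivrMr //.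
rewrite [leRHS]mulrC mulrA -natrM mul_bin_left natrM -mulrA ler_wpM2l ?ler0n //.
apply: le_trans (IH _ _ _ _ lg' sL cfg'' NR') _.
rewrite ler_wpM2l ?ler0n // lgE /potential qE -natr1.
(* A stale fetch costs 1 and lowers the potential by exactly 1. A clean one costs [1 - harmonic M]
   and raises it by [harmonic #|N'| - 1]. *)
by case: (w \in C0); rewrite /=; lra.
Qed.

(** * From the initial state to the start of phase [j] *)

Definition fetch_free (i : nat) lg := all (fun e => e.1 != i) lg.

Lemma fetch_free_cost lg : fetch_free j lg -> log_cost lg = 0.
Proof.
move=> /allP h; rewrite /log_cost.
have c b : count (pred1 (j, b)) lg = 0%N.
  by apply/count_memPn/negP => /h /=; rewrite eqxx.
by rewrite !c mulr0 subrr.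
Qed.

(** All that is tracked before phase [j]: the reset at its start rebuilds the pool from the cache
    alone. *)
Definition consistent s :=
  feasible dep k (cache s) /\ forall B, B \in buckets s -> B \subset cache s.

Lemma crowned_roots C N : closed C -> N \subset roots C -> crowned (C :\: N) N.
Proof.
move=> cC /subsetP Nr; have rC x : x \in N -> x \in C.
  by move=> /Nr; apply: subsetP (roots_sub C) _.
split.
- by rewrite disjoint_sym disjoints_subset; apply/subsetP => x xN; rewrite !inE xN.
- move=> z /setDP[zC zN]; rewrite subsetD (cC _ zC) disjoint_sym disjoints_subset.
  apply/subsetP => x xN; rewrite inE; apply: contra zN => xz.
  by rewrite (rootsP (Nr _ xN) zC xz).
move=> x xN; apply/subsetP => y yx; rewrite in_setU1 in_setD.
case: eqVneq => //= yx'; rewrite (subsetP (cC _ (rC _ xN)) _ yx) andbT.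
by apply/negP => yN; move: yx'; rewrite (rootsP (Nr _ yN) (rC _ xN) yx) eqxx.
Qed.

Lemma reset_trees C : reset_buckets dep C = trees set0 (roots C).
Proof. by apply: eq_imset => x; rewrite setD0. Qed.

Lemma discard_reset v C : feasible dep k C ->
  discard dep k tau C (remove_items (T v) (reset_buckets dep C)) =
  trees (T v) (roots C :\: T v).
Proof.
move=> /feasibleP[cC clC].
have E : (C :\: roots C) :|: roots C = C.
  by rewrite setUC -{1}(setIidPr (roots_sub C)) setID.
rewrite reset_trees.
have := @discard_trees_request v (C :\: roots C) (roots C) (roots C) set0.
rewrite E set0U; apply=> //; first exact: crowned_roots.
by rewrite disjoints_subset setC0 subsetT.
Qed.

(** If even a fresh pool is empty, all roots, and hence all cached items, lie in [T v]. As [w] is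
    missing, the cache is a proper subset of [T v], which has at most [k] items. So fetching with an
    empty pool never overfills the cache. *)
Lemma reset_room v w C : feasible dep k C -> w \in T v -> w \notin C ->
  discard dep k tau C (remove_items (T v) (reset_buckets dep C)) == set0 -> (#|C| < k)%N.
Proof.
move=> fC wv wC; rewrite discard_reset // trees_eq0 setD_eq0 => rv.
apply: leq_trans (card_T v); apply: proper_card.
apply/properP; split; last by exists w.
apply/subsetP => x /below_root[r rr]; apply: subsetP.
by apply: T_sub; apply: subsetP rr.
Qed.

(** Evicted items come from buckets that have lost [T v], so neither the dependencies of [w] nor the
    rest of the current request is disturbed. *)
Lemma process_consistent v w L C G ph C0 lg (c : rat) :
  feasible dep k C -> (forall B, B \in G -> B \subset C :\: T v) ->
  (forall B, B \in G -> ~~ frozen dep k tau C B) ->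
  (w \notin C -> G == set0 -> (#|C| < k)%N) ->
  servable ((v, w) :: L) C ->
  (forall s, consistent s -> servable L (cache s) -> phase s = ph ->
     (log s = lg \/ exists b, log s = rcons lg (ph, b)) -> value L s <= c) ->
  expect (process w C G ph C0 lg) (value L) <= c.
Proof.
move=> /feasibleP[cC clC] GC Gu room [wv wC sL] h.
have GC' B : B \in G -> B \subset C by move=> /GC; rewrite subsetD => /andP[].
apply: expect_process_le => //.
- move=> wC'; apply: h => /=; [split=> //; exact/feasibleP| |by []|by left].
  by apply: sL; rewrite subUset sub1set wC' subsetIl.
- move=> wC' F; have lt : (#|C| < k)%N by case/orP: F => // /room; apply.
  apply: h => /=; [split=> /=|by apply: sL; rewrite setUS ?subsetIl|by []|by right; eexists].
    apply/feasibleP; split; first by rewrite cardsU1 wC'.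
    move=> z; rewrite in_setU1 => /predU1P[->//|/clC zC].
    exact: subset_trans zC (subsetUr _ _).
  by move=> B /GC' BC; apply: subset_trans BC (subsetUr _ _).
move=> B y wC' kC BG yB /feasibleP[cy cly].
have := subsetP (GC _ BG) _ (taumax_in yB); rewrite in_setD => /andP[yv yC].
apply: h => /=; [split=> /=| |by []|by right; eexists].
- apply/feasibleP; split.
    by rewrite cardsU1 !inE (negbTE wC') andbF add1n (cardsD1 y C) yC in cC *.
  move=> z; rewrite in_setU1 => /predU1P[->|/cly zC]; last first.
    exact: subset_trans zC (subsetUr _ _).
  apply/subsetP => x xw; have := subsetP wC _ xw; rewrite !inE.
  case: eqP => //= _ ->; rewrite andbT; apply: contraNneq yv => <-.
  by apply: subsetP xw; apply: T_sub.
- move=> B'; rewrite inE => /andP[/imsetP[B'' /GC' BC ->] _].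
  by apply: subset_trans (subsetUr _ _); apply: setSD.
apply: sL; rewrite setUS //; apply/subsetP => x /setIP[xC xv].
by rewrite !inE xC andbT; apply: contraNneq yv => <-.
Qed.

Lemma value_before L s : (phase s < j)%N -> fetch_free j (log s) ->
  consistent s -> servable L (cache s) -> value L s <= 0.
Proof.
elim: L s => [|[v w] L IH] s sj ff [fC BC] sL; first by rewrite /= fetch_free_cost.
rewrite [value _ _]/= stepE /=.
set C := cache s in fC BC sL *.
have ffr i b : (i < j)%N -> fetch_free j (rcons (log s) (i, b)).
  by move=> ij; rewrite /fetch_free all_rcons /= ltn_eqF.
have dC G : (forall B, B \in G -> B \subset C) -> forall B,
    B \in discard dep k tau C (remove_items (T v) G) -> B \subset C :\: T v.
  by move=> GC B; rewrite inE => /andP[/imsetP[B' /GC B'C ->] _]; apply: setSD.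
have [cC clC] := feasibleP _ fC.
case: ifPn => [_|G0]; last first.
  apply: (process_consistent _ _ _ _ _ sL) => //.
  - exact: dC.
  - by move=> B; apply: discard_unfrozen.
  - by rewrite (negbTE G0).
  move=> s' cs' sL' ps' ls'; apply: IH; rewrite ?ps' //.
  by case: ls' => [->//|[b ->]]; apply: ffr.
have rC B : B \in reset_buckets dep C -> B \subset C.
  by move=> /imsetP[x xr ->]; apply: clC; apply: subsetP xr; apply: roots_sub.
(* The reset opens either another phase before [j] or phase [j] itself. *)
case: (ltngtP (phase s).+1 j) => [sj'|js|sj'].
- apply: (process_consistent _ _ _ _ _ sL) => //.
  + exact: dC.
  + by move=> B; apply: discard_unfrozen.
  + by move=> wC G0; case: sL => wv _ _; exact: reset_room fC wv wC G0.
  move=> s' cs' sL' ps' ls'; apply: IH; rewrite ?ps' //.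
  by case: ls' => [->//|[b ->]]; apply: ffr.
- by move: js; rewrite ltnNge sj.
have [wv Tw _] := sL; rewrite sj' discard_reset //.
set N := roots C :\: T v.
have Nr : N \subset roots C := subsetDl _ _.
have NC : N \subset C := subset_trans Nr (roots_sub C).
have E : (C :\: N) :|: N = C
  by rewrite setUC -{1}(setIidPr NC) setID.
have cN := crowned_roots clC Nr.
(* If [N] is empty, phase [j] consists of this iteration only. A fetch in it is clean, as [C] is
   also the cache at the start of the phase, and costs [1 - harmonic M <= 0]. *)
case: (eqVneq N set0) => [->|N0].
  have t0 : trees (T v) set0 = set0 by apply/eqP; rewrite trees_eq0.
  rewrite t0; apply: expect_process_le => [B|_|wC _|B y _ _]; rewrite ?inE //.
    by apply: le_trans (value_no_bucket _ _ _) _; rewrite //= fetch_free_cost.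
  apply: le_trans (value_no_bucket _ _ _) _ => //=.
  rewrite log_cost_rcons fetch_free_cost // eqxx wC mul1r mulr1 add0r subr_le0.
  by apply: harmonic_ge1; apply: ell_gt0 v.
have NX : [disjoint N & T v].
  by rewrite disjoints_subset; apply/subsetP => x; rewrite !inE => /andP[].
have sub_rest A : A \subset C -> A :&: T v \subset C :\: N.
  move=> AC; apply/subsetP => x /setIP[xA xv].
  by rewrite in_setD (subsetP AC) // andbT (disjointFl NX xv).
(* Removing [T v] a second time changes nothing, so the iteration that resets can be read as an
   ordinary step inside phase [j]. *)
have -> : process w C (trees (T v) N) j C (log s) =
    step dep k tau v w (phase_state C (C :\: N) N (T v) (log s)).
  rewrite stepE /= (discard_trees_request _ cN) ?E // setUid (setDidPl NX).
  by rewrite trees_eq0 (negbTE N0).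
have sN : servable ((v, w) :: L) (C :\: N).
  have [_ _ sL'] := sL; split=> //.
    apply/subsetP => x xw; have := subsetP Tw _ xw; rewrite !in_setU1.
    case: eqP => //= _ xC; apply: subsetP (sub_rest _ (subxx C)) _ _.
    by rewrite inE xC (subsetP (T_sub wv)).
  move=> C' CC'; apply: sL'; apply: subset_trans CC'; apply: setUS.
  by rewrite subsetI sub_rest // subsetIr.
have cfg : phase_config C (C :\: N) N #|N|.
  split=> //; first exact: leq_trans (subset_leq_card Nr) (card_roots cC).
  by rewrite -(cardsID N C) (setIidPr NC) addnC in cC *.
(* At the start all roots in [N] are live: the sum has the single term [A = N], and the potential is
   0 because [q], [n] and [a] all equal [#|N|]. *)
have := phase_bound (log s) sN cfg NX.
rewrite sum_drawsT binn mul1r fetch_free_cost // add0r => /le_trans; apply.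
by rewrite setDDr setDv set0U (setIidPr NC) /potential subrr mul0r add0r subrr.
Qed.

(** * The whole run *)

Lemma expect_value d L :
  expect (foldl (fun d vw => bind d (step dep k tau vw.1 vw.2)) d L)
    (fun s => log_cost (log s)) = expect d (value L).
Proof. by elim: L d => [|vw L IH] d //=; rewrite IH expect_bind. Qed.

Lemma run_foldl d reqs :
  foldl (serve dep k tau) d reqs =
  foldl (fun d vw => bind d (step dep k tau vw.1 vw.2)) d (pseudo_requests reqs).
Proof.
elim: reqs d => //= v reqs IH d; rewrite foldl_cat IH; congr foldl.
by rewrite /serve; elim: pseudo d => //= w ws IHw d; rewrite IHw.
Qed.

Lemma expect_log_cost_le0 reqs :
  expect (run dep k tau reqs) (fun s => log_cost (log s)) <= 0.
Proof.
rewrite /run run_foldl expect_value expect_dirac.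
have b0 : reset_buckets dep set0 = set0.
  by apply/eqP; rewrite reset_trees trees_eq0 -subset0 roots_sub.
(* Phase 0 contains no iteration: the initial pool is empty, so the first iteration resets. *)
case: (posnP j) => [j0|j0].
  by apply: le_trans (value_no_bucket _ _ _) _; rewrite ?j0 //= fetch_free_cost.
apply: value_before => //; last exact: servable_requests.
split=> [|B]; last by rewrite /= b0 inE.
by apply/feasibleP; split=> [|x]; rewrite ?cards0 ?inE.
Qed.

End Value.
End Bucketing.

Theorem mainTheorem5 (U : finType) (dep : rel U) (k : nat) (tau : U -> nat)
  (Hk : 0 < k) (Hdag : dag dep) (Hdeps : deps_bounded dep k) (Htau : tau_order dep tau)
  (reqs : seq U) (j : nat) :
  (expect (run dep k tau reqs)
     (fun s => (clean_fetches j s + stale_fetches j s)%:R)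
   <= harmonic (minn k (ell dep)) *
      expect (run dep k tau reqs) (fun s => (clean_fetches j s)%:R))%R.
Proof.
rewrite -subr_le0 -expectZ -expectB; exact: expect_log_cost_le0.
Qed.
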